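(* Let $K$ be a division ring, $n>1$, and let $S=K[\underline{t};\sigma,\underline{\delta}]$ be a multivariate Ore extension in $n$ variables. Then the center $Z(S)$ of $S$ is $$Z(K)_{(\sigma,\underline{\delta})}=\{a\in K \mid ab=ba \ \ \forall\, b\in K;\ \sigma(a)=a\cdot I_n;\ \delta_i(a)=0\ \ \forall\, 1\le i\le n\}.$$
   Context: All rings are associative with identity, and ring homomorphisms preserve the identity. Here $\sigma:K\to M_n(K)$ is a ring homomorphism with $\sigma_{ij}(a)$ denoting the $(i,j)$ entry of $\sigma(a)$, and $\underline{\delta}=(\delta_1,\dots,\delta_n)^t$ is a column of additive maps $K\to K$ forming a $\sigma$-derivation: $\delta_i(ab)=\sum_{j=1}^n\sigma_{ij}(a)\delta_j(b)+\delta_i(a)b$ for all $a,b\in K$, $1\le i\le n$. The multivariate Ore extension $S=K[\underline{t};\sigma,\underline{\delta}]$ is the ring of (finite) sums $\sum_{m\in M}\alpha_m m$, $\alpha_m\in K$, where $M$ is the free monoid on the variables $t_1,\dots,t_n$ (so $S$ is a free left $K$-module with basis $M$), with multiplication determined by concatenation in $M$ and the rules $t_ia=\sum_{j=1}^n\sigma_{ij}(a)t_j+\delta_i(a)$ for $a\in K$, $1\le i\le n$. $I_n$ is the identity matrix, and $K$ is viewed as the subring of constants of $S$. *)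

(* Defs.v *)
From HB Require Import structures.
From mathcomp Require Import all_boot all_order all_algebra.

Set Implicit Arguments.
Unset Strict Implicit.
Unset Printing Implicit Defensive.

Import GRing.Theory.
Local Open Scope ring_scope.

Definition division_ring (K : unitRingType) : Prop :=
  forall a : K, a != 0 -> a \is a GRing.unit.

Definition ring_center (R : pzRingType) (x : R) : Prop :=
  forall y : R, x * y = y * x.

Definition sigma_derivation (K : pzRingType) (n : nat)
    (sigma : {rmorphism K -> 'M[K]_n}) (delta : 'I_n -> {additive K -> K}) :
    Prop :=
  forall (a b : K) (i : 'I_n),
    delta i (a * b) = \sum_(j < n) sigma a i j * delta j b + delta i a * b.

(* The family [e] may be infinite: finite combinations are indexed by
   duplicate-free sequences of indices. *)
Definition left_basis (K : pzRingType) (V : lmodType K) (I : eqType)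
    (e : I -> V) : Prop :=
  (forall v : V, exists (s : seq I) (c : I -> K),
     uniq s /\ v = \sum_(m <- s) c m *: e m) /\
  (forall (s : seq I) (c : I -> K),
     uniq s -> \sum_(m <- s) c m *: e m = 0 -> forall m, m \in s -> c m = 0).

(* The free monoid on t_0, ..., t_(n-1) is encoded by words in [seq 'I_n]. *)
Definition word_monomial (R : pzRingType) (n : nat) (t : 'I_n -> R)
    (w : seq 'I_n) : R :=
  \prod_(i <- w) t i.

(* [S : lalgType K] does not require [K] to be commutative nor its image to be
   central: it is a ring [S] with a ring morphism [a |-> a%:A] from [K], where
   the left [K]-module structure is [a *: f = a%:A * f].  The two conditions
   determine [(S, t)] up to a unique isomorphism over [K]; the freeness of the
   monomials makes [a |-> a%:A] injective. *)
Record multivariate_ore_extension (K : nzRingType) (n : nat)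
    (sigma : {rmorphism K -> 'M[K]_n}) (delta : 'I_n -> {additive K -> K})
    (S : lalgType K) (t : 'I_n -> S) : Prop := MultivariateOreExtension {
  ore_basis : left_basis (word_monomial t);
  ore_rule : forall (i : 'I_n) (a : K),
    t i * a%:A = \sum_(j < n) sigma a i j *: t j + (delta i a)%:A
}.

Definition constant_center (K : pzRingType) (n : nat)
    (sigma : {rmorphism K -> 'M[K]_n}) (delta : 'I_n -> {additive K -> K})
    (a : K) : Prop :=
  [/\ ring_center a, sigma a = a%:M & forall i : 'I_n, delta i a = 0].

(* Main.v *)
Require Import Defs.
From HB Require Import structures.
From mathcomp Require Import all_boot all_order all_algebra.

Set Implicit Arguments.
Unset Strict Implicit.
Unset Printing Implicit Defensive.

Import GRing.Theory.
Local Open Scope ring_scope.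

(** Let [f] be central and suppose that it has positive degree [d].  Choose a
    word [w] of length [d] in its support, ending in [t_k], and some [i <> k].
    In degree [d + 1], every word of [f * t_i] ends in [t_i], whereas for each
    [j] the coefficient of [t_j w] in [t_i * f] is [sigma_ij (alpha_w)].  Hence
    row [i] of the matrix [sigma (alpha_w)] vanishes, which is impossible since
    [alpha_w], and so [sigma (alpha_w)], is invertible.  Thus [f] is a constant,
    and the conditions on it follow by comparing coefficients. *)

(* Over a basis this relation between [v] and [a] is the graph of a linear form;
   a relation is used because the existential in [left_basis] cannot be turned
   into a function without a choice axiom. *)
Definition is_coef (K : pzRingType) (V : lmodType K) (I : eqType) (e : I -> V)
    (w : I) (v : V) (a : K) : Prop :=
  exists r : seq (K * I),
    v = \sum_(p <- r) p.1 *: e p.2 /\ a = \sum_(p <- r | p.2 == w) p.1.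

Section Coefficients.
Variables (K : pzRingType) (V : lmodType K) (I : eqType) (e : I -> V).

Lemma is_coef0 w : is_coef e w 0 0.
Proof. by exists [::]; rewrite !big_nil. Qed.

Lemma is_coefD w u v a b :
  is_coef e w u a -> is_coef e w v b -> is_coef e w (u + v) (a + b).
Proof.
by move=> [r [-> ->]] [r' [-> ->]]; exists (r ++ r'); rewrite !big_cat.
Qed.

Lemma is_coefZ w v a b : is_coef e w v a -> is_coef e w (b *: v) (b * a).
Proof.
move=> [r [-> ->]]; exists [seq (b * p.1, p.2) | p <- r].
rewrite !big_map scaler_sumr mulr_sumr; split=> //.
by apply: eq_bigr => p _; rewrite scalerA.
Qed.

Lemma is_coef_basis w m : is_coef e w (e m) (m == w)%:R.
Proof.
exists [:: (1, m)]; rewrite big_seq1 big_cons big_nil /= scale1r; split=> //.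
by case: eqP; rewrite ?addr0.
Qed.

Lemma is_coef_sum (J : Type) (s : seq J) w (v : J -> V) (a : J -> K) :
  (forall j, is_coef e w (v j) (a j)) ->
  is_coef e w (\sum_(j <- s) v j) (\sum_(j <- s) a j).
Proof.
move=> va; elim: s => [|j s IHs]; first by rewrite !big_nil; apply: is_coef0.
by rewrite !big_cons; apply: is_coefD.
Qed.

(** The list [r] may repeat indices, so its terms are first grouped by index over [undup]; freeness
    then kills each grouped coefficient. If [w] does not occur in [r], the sum is empty. *)
Lemma is_coef_zero w a : left_basis e -> is_coef e w 0 a -> a = 0.
Proof.
move=> [_ free_e] [r [r0 ->]].
pose s := undup [seq p.2 | p <- r].
pose c m := \sum_(p <- r | p.2 == m) p.1.
have c0 : forall m, m \in s -> c m = 0.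
  apply: free_e; first exact: undup_uniq.
  rewrite [RHS]r0 /c.
  under eq_bigr do rewrite scaler_suml.
  rewrite (exchange_big_dep xpredT) //= !big_seq; apply: eq_bigr => p rp.
  under eq_bigl do rewrite eq_sym.
  rewrite -big_filter filter_pred1_uniq ?undup_uniq ?big_seq1 //.
  by rewrite mem_undup map_f.
have [/c0 //|ws] := boolP (w \in s).
rewrite big_seq_cond big1 // => p /andP[rp /eqP pw].
by move: ws; rewrite mem_undup -pw map_f.
Qed.

Lemma is_coef_uniq w v a b :
  left_basis e -> is_coef e w v a -> is_coef e w v b -> a = b.
Proof.
move=> be va vb; apply/eqP; rewrite -subr_eq0; apply/eqP.
apply: (is_coef_zero (w := w)) => //.
by rewrite -(subrr v) -scaleN1r -[- b]mulN1r; apply/is_coefD/is_coefZ.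
Qed.

End Coefficients.

(** If row [i] of [sigma u] were zero, so would be the [(i, i)] entry of [sigma u *m sigma u^-1],
    which is 1. *)
Lemma rmorph_unit_row_neq0 (K : unitRingType) (n : nat)
    (sigma : {rmorphism K -> 'M[K]_n}) (u : K) (i : 'I_n) :
  u \is a GRing.unit -> exists j, sigma u i j != 0.
Proof.
move=> uU; apply/existsP; apply: contraT => /existsPn row0.
have /matrixP/(_ i i) : sigma u *m sigma u^-1 = 1%:M.
  by rewrite mulmxE -rmorphM divrr // rmorph1.
rewrite !mxE eqxx big1 => [/eqP|j _]; first by rewrite eq_sym oner_eq0.
by move: (row0 j); rewrite negbK => /eqP->; rewrite mul0r.
Qed.

Lemma exists_longest_word (T : eqType) (P : pred (seq T)) (s : seq (seq T)) :
  has P s -> exists w, [/\ w \in s, P w &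
    forall m, m \in s -> P m -> (size m <= size w)%N].
Proof.
move=> sP; pose Q N := has (fun m => P m && (size m == N)) s.
have exQ : exists N, Q N.
  case/hasP: sP => m sm Pm; exists (size m); apply/hasP; exists m => //.
  by rewrite Pm /=.
have ubQ N : Q N -> (N <= \max_(m <- s) size m)%N.
  by case/hasP => m sm /andP[_ /eqP <-]; apply: leq_bigmax_seq.
case: (ex_maxnP exQ ubQ) => N /hasP[w sw /andP[Pw /eqP wN]] maxN.
exists w; split=> // m sm Pm; rewrite wN; apply: maxN; apply/hasP.
by exists m; rewrite ?Pm /=.
Qed.

Section OreExtension.
Variables (K : unitRingType) (n : nat).
Variables (sigma : {rmorphism K -> 'M[K]_n}).
Variables (delta : 'I_n -> {additive K -> K}).
Variables (S : lalgType K) (t : 'I_n -> S).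
Hypothesis hS : multivariate_ore_extension sigma delta t.
Local Notation mon := (word_monomial t).

Let basis_mon : left_basis mon := ore_basis hS.

Lemma word_monomial_nil : mon [::] = 1.
Proof. exact: big_nil. Qed.

Lemma word_monomial_cons i w : mon (i :: w) = t i * mon w.
Proof. exact: big_cons. Qed.

Lemma word_monomial_rcons w i : mon (rcons w i) = mon w * t i.
Proof. by rewrite /word_monomial -cats1 big_cat big_seq1. Qed.

(** Coefficients stand on the left, so the commutation rule is applied once and [w] survives intact
    as a suffix of every resulting word. *)
Lemma ore_mul_var i a w :
  t i * (a *: mon w) =
  \sum_(j < n) sigma a i j *: mon (j :: w) + delta i a *: mon w.
Proof.
rewrite -[a *: _]mulr_algl mulrA (ore_rule hS) mulrDl mulr_suml mulr_algl.
by congr (_ + _); apply: eq_bigr => j _; rewrite word_monomial_cons scalerAl.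
Qed.

Lemma is_coef_algC w a : is_coef mon w a%:A (a * (w == [::])%:R).
Proof.
by rewrite -word_monomial_nil eq_sym; apply/is_coefZ/is_coef_basis.
Qed.

Lemma is_coef_var_mul i a m w :
  is_coef mon w (t i * (a *: mon m))
    (\sum_(j < n) sigma a i j * (j :: m == w)%:R + delta i a * (m == w)%:R).
Proof.
rewrite ore_mul_var; apply: is_coefD; last exact/is_coefZ/is_coef_basis.
by apply: is_coef_sum => j; apply/is_coefZ/is_coef_basis.
Qed.

Lemma is_coef_mul_var i a m w :
  is_coef mon w ((a *: mon m) * t i) (a * (rcons m i == w)%:R).
Proof.
by rewrite -scalerAl -word_monomial_rcons; apply/is_coefZ/is_coef_basis.
Qed.

Lemma ring_center_constant (f : S) :
  division_ring K -> (1 < n)%N -> ring_center f -> exists a, f = a%:A.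
Proof.
move=> hK hn fC; have [s [c [us fE]]] := basis_mon.1 f.
(* Excluding the empty word makes the failure of [P] on [s] mean that [f] is constant, and
   guarantees a last letter otherwise. *)
pose P m := (c m != 0) && (m != [::]).
have [sP|/hasPn sP] := boolP (has P s); last first.
  exists (\sum_(m <- s) c m); rewrite fE scaler_suml.
  apply: eq_big_seq => m /sP; rewrite negb_and !negbK.
  by case/orP => /eqP ->; rewrite ?scale0r // word_monomial_nil.
have [w [sw /andP[cw w0] maxw]] := exists_longest_word sP.
case/lastP: w => [|w k] // in sw cw w0 maxw *.
have [i ik] : exists i : 'I_n, i != k.
  have [k0|k0] := eqVneq (val k) 0%N.
    by exists (Ordinal hn); rewrite -val_eqE /= k0.
  by exists (Ordinal (ltnW hn)); rewrite -val_eqE eq_sym.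
(* The goal is now that this nonzero entry vanishes: it is the coefficient of [x] in [t i * f],
   while that in [f * t i] is 0. *)
have [j /eqP[]] := rmorph_unit_row_neq0 sigma i (hK _ cw).
pose x := j :: rcons w k.
have fti : is_coef mon x (f * t i) 0.
  suff <- : \sum_(m <- s) c m * (rcons m i == x)%:R = 0.
    by rewrite fE mulr_suml; apply: is_coef_sum => m; apply: is_coef_mul_var.
  rewrite big1 // => m _.
  by rewrite /x -rcons_cons eqseq_rcons (negPf ik) andbF mulr0.
have tif : is_coef mon x (t i * f) (sigma (c (rcons w k)) i j).
  suff <- : \sum_(m <- s) (\sum_(l < n) sigma (c m) i l * (l :: m == x)%:R
      + delta i (c m) * (m == x)%:R) = sigma (c (rcons w k)) i j.
    by rewrite fE mulr_sumr; apply: is_coef_sum => m; apply: is_coef_var_mul.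
  rewrite (bigD1_seq (rcons w k)) //= [\sum_(m <- s | _) _]big1_seq ?addr0.
    rewrite (bigD1 j) //= eqxx mulr1 big1 => [|l lj]; last first.
      by rewrite eqseq_cons (negPf lj) mulr0.
    have /negPf-> : rcons w k != x.
      by apply/eqP => /(congr1 size)/eqP; rewrite ltn_eqF.
    by rewrite mulr0 !addr0.
  move=> m /andP[mw sm]; rewrite big1 ?add0r => [|l _]; last first.
    by rewrite eqseq_cons (negPf mw) andbF mulr0.
  (* The [delta] term can only contribute at [m = x], but [x] is one letter longer than the longest
     word, so its coefficient is 0. *)
  have [mx|] := eqVneq m x; last by rewrite mulr0.
  suff /eqP-> : c m == 0 by rewrite raddf0 mul0r.
  apply: contraT => cm; have := maxw m sm; rewrite /P cm mx /= ltnn.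
  by move=> /(_ isT).
by apply: is_coef_uniq tif _ => //; rewrite -fC.
Qed.

Lemma ring_center_algP (a : K) :
  ring_center (a%:A : S) <-> constant_center sigma delta a.
Proof.
split=> [aC|[aC sa da]].
  (* Both sides are the coefficient of [w] in [t i * a%:A = a%:A * t i]. One-letter words will yield
     the condition on [sigma], the empty word that on [delta]. *)
  have E i w : \sum_(j < n) sigma a i j * ([:: j] == w)%:R
      + delta i a * ([::] == w)%:R = a * ([:: i] == w)%:R.
    apply: is_coef_uniq (is_coef_var_mul i a [::] w) _ => //.
    by rewrite word_monomial_nil -aC -word_monomial_nil; apply: is_coef_mul_var.
  split=> [b||i].
  - have ab := is_coef_algC [::] (a * b); have ba := is_coef_algC [::] (b * a).
    rewrite eqxx !mulr1 in ab ba; apply: is_coef_uniq ab _ => //.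
    by rewrite -scalerA -mulr_algl aC mulr_algl scalerA.
  - apply/matrixP => i j; rewrite mxE -mulr_natr.
    have := E i [:: j]; rewrite mulr0 addr0 (bigD1 j) //= eqxx mulr1 big1.
      by rewrite addr0 eqseq_cons andbT.
    by move=> l lj; rewrite eqseq_cons (negPf lj) mulr0.
  - have := E i [::]; rewrite mulr0 mulr1 big1 ?add0r // => l _.
    by rewrite mulr0.
have at_ i : a%:A * t i = t i * a%:A.
  rewrite (ore_rule hS) da scale0r addr0 sa (bigD1 i) //= mxE eqxx mulr1n.
  rewrite big1 ?addr0 ?mulr_algl // => j ji.
  by rewrite mxE eq_sym (negPf ji) scale0r.
(* Commuting with the variables extends to words by induction; [aC] then handles the
   coefficients. *)
have amon w : a%:A * mon w = mon w * a%:A.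
  elim: w => [|i w IHw]; first by rewrite word_monomial_nil mulr1 mul1r.
  by rewrite word_monomial_cons mulrA at_ -mulrA IHw mulrA.
move=> y; have [s [c [_ ->]]] := basis_mon.1 y.
rewrite mulr_sumr mulr_suml; apply: eq_bigr => m _.
by rewrite -(scalerAl (c m)) -amon !mulr_algl !scalerA aC.
Qed.

End OreExtension.

Theorem proposition3p1 (K : unitRingType) (n : nat)
  (sigma : {rmorphism K -> 'M[K]_n}) (delta : 'I_n -> {additive K -> K})
  (S : lalgType K) (t : 'I_n -> S)
  (hK : division_ring K) (hn : (1 < n)%N)
  (hdelta : sigma_derivation sigma delta)
  (hS : multivariate_ore_extension sigma delta t) :
  forall f : S,
    ring_center f <->
    exists a : K, constant_center sigma delta a /\ f = a%:A.
Proof.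
move=> f; split=> [fC|[a [aC ->]]]; last exact/(ring_center_algP hS).
have [a fa] := ring_center_constant hS hK hn fC.
by exists a; split=> //; apply/(ring_center_algP hS); rewrite -fa.
Qed.
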